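(* Consider the continuous-time finite single-hop network with $N$ queues and utility-maximising service rates described in the context. Let $\bar\nu\in\mathcal{C}$ and $\varepsilon>0$ be such that $\lambda_i<\nu_i-\varepsilon$ for all $i$. Let $\bar X$ be a random vector with the stationary distribution of the (positive recurrent) process $\bar X(\cdot)$. Then $$\sum_i h'(\nu_i)\,\mathbb{E}(g(X_i))\ \le\ \frac1\varepsilon\sum_i h'(\nu_i)\,\mathbb{E}(\Delta(X_i)).$$
   Context: Model. There are $N<\infty$ queues with state $\bar X(t)=(X_1(t),\dots,X_N(t))\in\mathbb{Z}_+^N$. Arrivals to queue $i$ form a Poisson process of constant rate $\lambda_i$, independent of all other processes. The instantaneous departure rate from queue $i$ at time $t$, given $\bar X(t)$, is $\psi_i(\bar X(t))$: the number of departures from queue $i$ up to time $t$ is $\Pi_i\bigl(\int_0^t\psi_i(\bar X(\tau))\,d\tau\bigr)$, where $\Pi_i$ are independent unit-rate Poisson processes. The process is a countable-state Markov process, assumed irreducible. Service rates. It is assumed that $\psi_i(\bar x)\in[0,1]$, that $\psi_i(\bar x)=0$ if $x_i=0$, and that for every $\bar x$ $$\bar\psi(\bar x)\in\arg\max_{\bar\mu\in\mathcal{C}}\ \sum_i g(x_i)h(\mu_i),$$ where $\mathcal{C}\subset\mathbb{R}_+^N$ is compact and coordinate-convex (if $\bar\mu\in\mathcal{C}$ and $0\le\bar\mu^*\le\bar\mu$ coordinate-wise, then $\bar\mu^*\in\mathcal{C}$); $\mathcal{C}$ is not assumed convex. The convention $0\cdot(-\infty)=0$ is used. Condition on $h$: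 $h:[0,\infty)\to\mathbb{R}$ is strictly increasing, differentiable and concave, where both $\lim_{y\downarrow0}h(y)=h(0)>-\infty$ and $\lim_{y\downarrow 0}h(y)=-\infty$ (with $h(0)=-\infty$) are allowed. Condition on $g$: $g:\mathbb{Z}_+\to[0,\infty)$ is strictly increasing and $g(y)/\Delta(y)\to\infty$ as $y\to\infty$, where $\Delta(y)=g(y+1)-g(y)$ (equivalently $g(y+1)/g(y)\to1$). Under these assumptions the process is positive recurrent, so the stationary distribution exists and is unique. *)

(* Defs.v *)
From HB Require Import structures.
From mathcomp Require Export all_boot all_order all_algebra.
From mathcomp Require Export all_classical all_reals all_analysis.

Set Implicit Arguments.
Unset Strict Implicit.
Unset Printing Implicit Defensive.

Export Order.TTheory GRing.Theory Num.Theory.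
Export numFieldNormedType.Exports.

Local Open Scope classical_set_scope.
Local Open Scope ring_scope.

Definition mutually_independent (R : realType) (d : measure_display)
    (Omega : measurableType d) (P : probability Omega R) (I : finType)
    (F : I -> set_system Omega) : Prop :=
  (* Each F k is meant to be a sigma-algebra.  Since setT then belongs to every
     F k, the product rule over all of I gives it for every subfamily. *)
  forall E : I -> set Omega, (forall k, F k (E k)) ->
    P (\bigcap_(k in [set: I]) E k) = (\prod_(k : I) fine (P (E k)))%:E.

Definition sigma_of_variable (d d' : measure_display)
    (Omega : measurableType d) (T : measurableType d') (Z : Omega -> T) :
    set_system Omega :=
  preimage_set_system [set: Omega] Z measurable.

Definition sigma_of_process (R : realType) (d : measure_display)
    (Omega : measurableType d) (Z : R -> Omega -> nat) : set_system Omega :=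
  <<s \bigcup_(t in [set t : R | 0 <= t]) sigma_of_variable (Z t) >>.

(* Processes are indexed by R, but only their values at times t >= 0 matter.
   The second argument of poisson_prob is a phantom; for a zero parameter
   poisson_prob is the Dirac mass at 0. *)
Record poisson_process (R : realType) (d : measure_display)
    (Omega : measurableType d) (P : probability Omega R)
    (rate : R) (A : R -> Omega -> nat) : Prop := {
  poisson_measurable : forall t : R, 0 <= t -> measurable_fun [set: Omega] (A t);
  poisson_start : forall w, A 0 w = 0%N;
  poisson_nondecreasing : forall w (s t : R), 0 <= s -> s <= t ->
    (A s w <= A t w)%N;
  poisson_right_continuous : forall w (t : R), 0 <= t ->
    \forall s \near t^'+, A s w = A t w;
  poisson_increment : forall (s t : R) (U : set nat), 0 <= s -> s <= t ->
    P ((fun w => A t w - A s w)%N @^-1` U)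
      = poisson_prob (rate * (t - s)) 0%N U;
  poisson_independent_increments : forall (n : nat) (t : nat -> R),
    0 <= t 0%N -> {homo t : k l / (k <= l)%N >-> k <= l} ->
    mutually_independent P (fun k : 'I_n =>
      sigma_of_variable (fun w => A (t k.+1) w - A (t k) w)%N)
}.

(* h is extended-real valued so that h 0 may be -oo; the continuity clause
   covers both h 0 > -oo and h 0 = -oo.  Multiplication on \bar R satisfies
   0 * -oo = 0. *)
Record utility (R : realType) (h : R -> \bar R) : Prop := {
  utility_fin : forall y : R, 0 < y -> h y \is a fin_num;
  utility_right_limit : h y @[y --> 0^'+] --> h 0;
  utility_increasing : forall x y : R, 0 <= x -> x < y -> (h x < h y)%E;
  utility_differentiable : forall y : R, 0 < y -> derivable (fine \o h) y 1;
  utility_concave : forall x y p : R, 0 <= x -> 0 <= y -> 0 <= p -> p <= 1 ->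
    (p%:E * h x + (1 - p)%:E * h y <= h (p * x + (1 - p) * y)%R)%E
}.

Definition utility_deriv (R : realType) (h : R -> \bar R) : R -> R :=
  derive1 (fine \o h).

Definition increment (R : realType) (g : nat -> R) (y : nat) : R :=
  g y.+1 - g y.

Record weight (R : realType) (g : nat -> R) : Prop := {
  weight_ge0 : forall y, 0 <= g y;
  weight_increasing : forall x y, (x < y)%N -> g x < g y;
  weight_slow_growth : g y / increment g y @[y --> \oo] --> +oo
}.

Record rate_region (R : realType) (N : nat) (C : set 'rV[R]_N) : Prop := {
  region_ge0 : forall mu, C mu -> forall i, 0 <= mu ord0 i;
  region_compact : compact C;
  region_coordinate_convex : forall mu mu' : 'rV[R]_N, C mu ->
    (forall i, 0 <= mu' ord0 i /\ mu' ord0 i <= mu ord0 i) -> C mu'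
}.

Definition objective (R : realType) (N : nat) (h : R -> \bar R) (g : nat -> R)
    (x : N.-tuple nat) (mu : 'rV[R]_N) : \bar R :=
  (\sum_(i < N) (g (tnth x i))%:E * h (mu ord0 i))%E.

Record service_rates (R : realType) (N : nat) (C : set 'rV[R]_N)
    (h : R -> \bar R) (g : nat -> R)
    (psi : N.-tuple nat -> 'rV[R]_N) : Prop := {
  service_bounds : forall x i, 0 <= psi x ord0 i /\ psi x ord0 i <= 1;
  service_empty : forall x i, tnth x i = 0%N -> psi x ord0 i = 0;
  service_in_region : forall x, C (psi x);
  service_argmax : forall x mu, C mu ->
    (objective h g x mu <= objective h g x (psi x))%E
}.

Definition positive_rate (R : realType) (N : nat) (lam : 'I_N -> R)
    (psi : N.-tuple nat -> 'rV[R]_N) : rel (N.-tuple nat) := fun x y =>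
  [exists i,
    ((y == [tuple (tnth x j + (j == i))%N | j < N]) && (0 < lam i)) ||
    ((x == [tuple (tnth y j + (j == i))%N | j < N]) && (0 < psi x ord0 i))].

Definition irreducible (R : realType) (N : nat) (lam : 'I_N -> R)
    (psi : N.-tuple nat -> 'rV[R]_N) : Prop :=
  forall x y, exists p : seq (N.-tuple nat),
    path (positive_rate lam psi) x p /\ last x p = y.

Definition driving_sigma (R : realType) (N : nat) (d : measure_display)
    (Omega : measurableType d) (A S : 'I_N -> R -> Omega -> nat)
    (X : R -> Omega -> N.-tuple nat) (k : option ('I_N + 'I_N)) :
    set_system Omega :=
  match k with
  | None => sigma_of_variable (X 0)
  | Some (inl i) => sigma_of_process (A i)
  | Some (inr i) => sigma_of_process (S i)
  end.

Definition service_clock (R : realType) (N : nat)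
    (psi : N.-tuple nat -> 'rV[R]_N) (Omega : Type)
    (X : R -> Omega -> N.-tuple nat) (i : 'I_N) (t : R) (w : Omega) : R :=
  \int[lebesgue_measure]_(s in `[0, t]) psi (X s w) ord0 i.

(* A i counts the arrivals to queue i and S i is the unit-rate Poisson process
   which, run at service_clock psi X i, counts its departures.  The
   balance is written with sums because subtraction on nat is truncated. *)
Record network_process (R : realType) (N : nat) (lam : 'I_N -> R)
    (psi : N.-tuple nat -> 'rV[R]_N) (d : measure_display)
    (Omega : measurableType d) (P : probability Omega R)
    (A S : 'I_N -> R -> Omega -> nat)
    (X : R -> Omega -> N.-tuple nat) : Prop := {
  network_measurable : forall t : R, 0 <= t -> measurable_fun [set: Omega] (X t);
  network_arrivals : forall i, poisson_process P (lam i) (A i);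
  network_services : forall i, poisson_process P 1 (S i);
  network_independent : mutually_independent P (driving_sigma A S X);
  network_evolution : \forall w \ae P, forall (t : R) (i : 'I_N), 0 <= t ->
    (tnth (X t w) i
       + S i (service_clock psi X i t w) w
     = tnth (X 0%R w) i + A i t w)%N
}.

(* The network process started from law pi has law pi at every time.  The law
   of X t depends only on lam, psi and the law of X 0, not on the probability
   space carrying the process. *)
Definition stationary_distribution (R : realType) (N : nat) (lam : 'I_N -> R)
    (psi : N.-tuple nat -> 'rV[R]_N)
    (pi : probability (N.-tuple nat) R) : Prop :=
  exists (d : measure_display) (Omega : measurableType d)
    (P : probability Omega R) (A S : 'I_N -> R -> Omega -> nat)
    (X : R -> Omega -> N.-tuple nat),
    network_process lam psi P A S X /\
    forall (t : R) (B : set (N.-tuple nat)), 0 <= t -> measurable B ->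
      P (X t @^-1` B) = pi B.

(* Main.v *)
Require Import Defs.
From mathcomp Require Import measurable_realfun ring lra.

(* With V(x) = sum_i h'(nu_i) sum_(k < x_i) g(k+1), the tangent inequality for h
   turns the optimality of psi into a drift of V bounded above by
   - eps sum_i h'(nu_i) g(x_i) + sum_i h'(nu_i) Delta(x_i).  As V need not be
   integrable, stationarity is applied to the bounded function
   c = max (n - V, 0), and n goes to infinity by monotone convergence.

   Only one half of the generator identity is needed: the expectation of the
   generator of c is at most 0.  It follows from the lower bound on the law of
   X(t) given by three kinds of events described by the Poisson drivers alone
   (no jump, exactly one arrival, exactly one departure before time t), on
   letting t go to 0. *)

Set Implicit Arguments.
Unset Strict Implicit.
Unset Printing Implicit Defensive.

Local Open Scope classical_set_scope.
Local Open Scope ring_scope.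

(** * Service clocks and trajectories *)

(* No measurability is assumed: the trajectories of the network are not known
   to be measurable in time. *)
Lemma ge0_le_integral_nonmeasurable (d : measure_display)
    (T : measurableType d) (R : realType) (mu : {measure set T -> \bar R})
    (D : set T) (f1 f2 : T -> \bar R) :
  (forall x, D x -> (0 <= f1 x)%E) -> (forall x, D x -> (f1 x <= f2 x)%E) ->
  (\int[mu]_(x in D) f1 x <= \int[mu]_(x in D) f2 x)%E.
Proof.
move=> f1_ge0 f12.
have f2_ge0 x : D x -> (0 <= f2 x)%E.
  by move=> Dx; exact: le_trans (f1_ge0 _ Dx) (f12 _ Dx).
rewrite !ge0_integralE//; apply: le_ereal_sup => _ [h hf1 <-].
by exists h => // x; apply: le_trans (hf1 x) _; exact: lee_restrict.
Qed.

Section Clock.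
Variables (R : realType) (f : R -> R).

Definition clock (t : R) : R := \int[lebesgue_measure]_(s in `[0, t]) f s.

Lemma clock_cst (c t : R) : 0 <= t -> (forall s, 0 <= s <= t -> f s = c) ->
  clock t = c * t.
Proof.
move=> t_ge0 fc; rewrite /clock.
rewrite (@eq_Rintegral _ _ _ _ _ (cst c)); last first.
  by move=> s; rewrite inE/= in_itv/= => /fc.
rewrite Rintegral_cst//= lebesgue_measure_itv/= lte_fin.
case: ltP => [|t_le0] /=; first by rewrite subr0.
by rewrite (le_anti (introT andP (conj t_le0 t_ge0))) mulr0.
Qed.

Hypothesis f_ge0 : forall s, 0 <= f s.
Hypothesis f_le1 : forall s, f s <= 1.

Lemma clock_ge0 t : 0 <= clock t.
Proof. by apply/fine_ge0/integral_ge0 => s _; rewrite lee_fin. Qed.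

(** [f] need not be measurable, so it is compared with a measurable step function. The bound
    concerns the extended integral because finiteness is deduced from it. *)
Lemma clock_integral_le (c s t : R) : c \in `[0, 1] -> 0 <= s -> s <= t ->
  (forall r, 0 <= r < s -> f r <= c) ->
  (\int[lebesgue_measure]_(r in `[0%R, t]) (f r)%:E <= (c * s + (t - s))%:E)%E.
Proof.
rewrite in_itv/= => /andP[c0 c1] s0 st fc.
pose b r := if r < s then c else 1.
have b_ge0 r : 0 <= b r by rewrite /b; case: ifP.
apply: (@le_trans _ _
  (\int[lebesgue_measure]_(r in `[0%R, t]) (b r)%:E)%E).
  apply: ge0_le_integral_nonmeasurable => r /=; rewrite in_itv/= => /andP[r0 rt].
    by rewrite lee_fin.
  rewrite lee_fin /b; case: ltP => // rs.
  by apply: fc; rewrite r0.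
have -> : `[0, t]%classic = `[0, s[ `|` `[s, t] :> set R.
  by rewrite -itv_bndbnd_setU// bnd_simp.
have mb (D : set R) : measurable_fun D (EFin \o b).
  apply/measurable_EFinP/measurable_funTS/measurable_fun_ifT => //.
  exact: measurable_fun_ltr.
rewrite ge0_integral_setU//=; last 3 first.
- exact: mb.
- by move=> r _; rewrite lee_fin.
- rewrite disj_set2E; apply/eqP/seteqP; split => // r []/=.
  by rewrite !in_itv/= => /andP[_ rs] /andP[/(lt_le_trans rs)]; rewrite ltxx.
rewrite [X in (X + _)%E](_ : _ = (c * s)%:E); last first.
  rewrite (eq_integral (cst c%:E)); last first.
    by move=> r; rewrite inE/= in_itv/= /b => /andP[_ ->].
  rewrite integral_cst//= lebesgue_measure_itv/= lte_fin.
  case: ltP => [_|s_le0]; first by rewrite oppr0 adde0 EFinM.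
  by rewrite mule0 (le_anti (introT andP (conj s_le0 s0))) mulr0.
rewrite [X in (_ + X)%E](_ : _ = (t - s)%:E) ?lexx//.
rewrite (eq_integral (cst 1%:E)); last first.
  by move=> r; rewrite inE/= in_itv/= /b => /andP[sr _]; rewrite ltNge sr.
rewrite integral_cst//= lebesgue_measure_itv/= lte_fin mul1e.
case: ltP => [_|ts]; first by rewrite EFinB.
by rewrite (le_anti (introT andP (conj st ts))) subrr.
Qed.

Lemma clock_fin (t : R) : 0 <= t ->
  (\int[lebesgue_measure]_(r in `[0%R, t]) (f r)%:E)%E \is a fin_num.
Proof.
move=> t0; rewrite ge0_fin_numE; last first.
  by apply: integral_ge0 => s _; rewrite lee_fin.
apply: le_lt_trans (ltry (1 * t + (t - t))).
by apply: clock_integral_le => //; rewrite in_itv/= ler01 lexx.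
Qed.

Lemma clock_upper (c s t : R) : c \in `[0, 1] -> 0 <= s -> s <= t ->
  (forall r, 0 <= r < s -> f r <= c) -> clock t <= c * s + (t - s).
Proof.
move=> c01 s0 st fc; rewrite -lee_fin fineK ?clock_fin//; last first.
  exact: le_trans st.
exact: clock_integral_le.
Qed.

Lemma clock_le (t : R) : 0 <= t -> clock t <= t.
Proof.
move=> t0; have := @clock_upper 1 t t.
rewrite mul1r subrr addr0; apply => //.
by rewrite in_itv/= ler01 lexx.
Qed.

Lemma clock_nondecreasing (s t : R) : 0 <= s -> s <= t -> clock s <= clock t.
Proof.
move=> s0 st; apply: fine_le; [exact: clock_fin | exact/clock_fin/(le_trans s0) |].
rewrite integral_mkcond [leRHS]integral_mkcond.
apply: ge0_le_integral_nonmeasurable => r _.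
  by apply: erestrict_ge0 => u _; rewrite lee_fin.
rewrite /patch; case: ifPn => [|_].
  rewrite inE/= in_itv/= => /andP[r0 rs].
  by rewrite mem_set//= in_itv/= r0 (le_trans rs).
by case: ifPn => // _; rewrite lee_fin.
Qed.

End Clock.

(** * Single trajectories driven by deterministic counting paths *)

Section Path.
Variables (R : realType) (N : nat) (psi : N.-tuple nat -> 'rV[R]_N).
Variables (X : R -> N.-tuple nat) (A S : 'I_N -> R -> nat).
Hypothesis psi_bounds : forall x i, 0 <= psi x ord0 i /\ psi x ord0 i <= 1.
Hypothesis A_nondecreasing : forall i (s t : R), 0 <= s -> s <= t ->
  (A i s <= A i t)%N.
Hypothesis S_nondecreasing : forall i (s t : R), 0 <= s -> s <= t ->
  (S i s <= S i t)%N.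
Hypothesis S_right_continuous : forall i (t : R), 0 <= t ->
  \forall s \near t^'+, S i s = S i t.

Let service i := clock (fun s => psi (X s) ord0 i).

Hypothesis evolution : forall (t : R) i, 0 <= t ->
  (tnth (X t) i + S i (service i t) = tnth (X 0) i + A i t)%N.

Let psi_ge0 x i : 0 <= psi x ord0 i. Proof. by case: (psi_bounds x i). Qed.
Let psi_le1 x i : psi x ord0 i <= 1. Proof. by case: (psi_bounds x i). Qed.

Let service_ge0 i t : 0 <= service i t.
Proof. exact: clock_ge0. Qed.

Let service_le i (t : R) : 0 <= t -> service i t <= t.
Proof. exact: clock_le. Qed.

Let service_nondecreasing i (s t : R) : 0 <= s -> s <= t -> service i s <= service i t.
Proof. exact: clock_nondecreasing. Qed.

Let A_eq0 i (s t : R) : 0 <= s <= t -> A i t = 0%N -> A i s = 0%N.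
Proof.
by move=> /andP[s0 st] At; apply/eqP; rewrite -leqn0 -At A_nondecreasing.
Qed.

Let S_eq0 i (s t : R) : 0 <= s <= t -> S i t = 0%N -> S i s = 0%N.
Proof.
by move=> /andP[s0 st] St; apply/eqP; rewrite -leqn0 -St S_nondecreasing.
Qed.

(** A service clock runs no faster than real time, so a driver silent up to [t] produces no
    departure. *)
Lemma path_without_service (t : R) i : 0 <= t -> S i t = 0%N ->
  tnth (X t) i = (tnth (X 0%R) i + A i t)%N.
Proof.
move=> t0 St; rewrite -evolution// (S_eq0 _ St) ?addn0//.
by rewrite service_ge0 service_le.
Qed.

Lemma path_frozen (t : R) : 0 <= t -> (forall i, A i t = 0%N) ->
  (forall i, S i (service i t) = 0%N) ->
  forall s, 0 <= s <= t -> X s = X 0.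
Proof.
move=> t0 At St s /[dup] st /andP[s0 s_le]; apply: eq_from_tnth => i.
have := evolution i s0; rewrite (A_eq0 st (At i)).
by rewrite (S_eq0 _ (St i)) ?addn0// service_ge0 service_nondecreasing.
Qed.

(** At most one departure is possible since each clock is at most [t]. Were there none, [X] would be
    frozen and the clock of queue [i] would equal [psi (X 0) ord0 i * t], where [S i] has already
    jumped. *)
Lemma path_one_departure (t : R) i : 0 <= t -> (forall j, A j t = 0%N) ->
  (forall j, S j t = (j == i)) -> S i (psi (X 0) ord0 i * t) = 1%N ->
  forall j, (tnth (X t) j + (j == i))%N = tnth (X 0) j.
Proof.
move=> t0 At St Si j; have := evolution j t0; rewrite At addn0.
have Sle k : (S k (service k t) <= (k == i))%N.
  by rewrite -(St k) S_nondecreasing ?service_le.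
suff -> : S j (service j t) = (j == i) by [].
case: (eqVneq j i) (Sle j) => [->|_]; last by rewrite leqn0 => /eqP.
case Si0: (S i (service i t)) => [|[|//]] // _.
have Sk k : S k (service k t) = 0%N.
  have [->//|ki] := eqVneq k i.
  by have := Sle k; rewrite (negbTE ki) leqn0 => /eqP.
have XE := path_frozen t0 At Sk.
have : service i t = psi (X 0) ord0 i * t.
  by apply: clock_cst => // s /XE ->.
by move=> E; rewrite E Si in Si0.
Qed.

(* At the first instant at which [X] differs from [X 0], no service clock has
   run for longer than the time [psi_i (X 0) * t] at which it is still silent;
   right continuity then keeps [X] constant a little longer. *)
Lemma path_silent (t : R) : 0 <= t -> (forall i, A i t = 0%N) ->
  (forall i, S i (psi (X 0) ord0 i * t) = 0%N) -> X t = X 0.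
Proof.
move=> t0 At St; apply: contrapT => Xt.
pose B := [set s : R | 0 <= s <= t /\ X s <> X 0].
have Bt : B t by split; rewrite ?t0 ?lexx.
have hB : has_inf B.
  by split; [exists t | exists 0 => s [/andP[]]].
pose tau := inf B.
have tau_ge0 : 0 <= tau.
  by apply: lb_le_inf; [exists t | move=> s [/andP[]]].
have tau_le : tau <= t by apply: ge_inf => //; case: hB.
have before (s : R) : 0 <= s < tau -> X s = X 0.
  move=> /andP[s0 s_tau]; apply: contrapT => Xs.
  have : B s by split => //; rewrite s0 ltW// (lt_le_trans s_tau).
  by move/(ge_inf hB.2); rewrite leNgt s_tau.
have service_tau i (u : R) : tau <= u ->
    service i u <= psi (X 0) ord0 i * tau + (u - tau).
  move=> tau_u; apply: clock_upper => //.
    by rewrite in_itv/= psi_ge0 psi_le1.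
  by move=> r /before ->.
have psi_tau_ge0 i : 0 <= psi (X 0) ord0 i * tau by rewrite mulr_ge0.
have S_tau i : S i (psi (X 0) ord0 i * tau) = 0%N.
  by apply: S_eq0 (St i); rewrite psi_tau_ge0 ler_wpM2l.
(* Each queue has its own margin of right continuity; finitely many queues give a common one. *)
have [e e_gt0 Se] : exists2 e : R, 0 < e & forall i r,
    psi (X 0) ord0 i * tau <= r < psi (X 0) ord0 i * tau + e -> S i r = 0%N.
  have /choice[e eP] : forall i, exists e : R, 0 < e /\ forall r,
      psi (X 0) ord0 i * tau <= r < psi (X 0) ord0 i * tau + e -> S i r = 0%N.
    move=> i; have [e /= e_gt0 He] := S_right_continuous i (psi_tau_ge0 i).
    exists e; split => // r /andP[]; rewrite le_eqVlt => /predU1P[<- //|r1 r2].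
    rewrite -(S_tau i); apply: He => //=.
    by rewrite ltr0_norm ?subr_lt0// opprB ltrBlDl.
  exists (\big[Num.min/1]_i e i).
    by apply: lt_bigmin => // i _; case: (eP i).
  move=> i r /andP[r1 r2]; apply: (eP i).2; rewrite r1 (lt_le_trans r2)// lerD2l.
  exact: bigmin_le_cond.
(* At a time [u < tau + e] no clock has passed its silent margin, so [path_frozen] contradicts
   [X u <> X 0]. *)
have [u [/andP[u0 ut] Xu] u_tau] := @inf_adherent _ B e e_gt0 hB.
have tau_u : tau <= u by apply: (ge_inf hB.2); split; rewrite ?u0.
apply: Xu; apply: (path_frozen u0); rewrite ?u0 ?lexx//.
  by move=> i; rewrite (@A_eq0 _ u t)// u0.
move=> i; apply: (@S_eq0 _ _ (psi (X 0) ord0 i * tau + (u - tau))).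
  by rewrite service_ge0 service_tau.
by apply: Se; rewrite lerDl subr_ge0 tau_u ltrD2l ltrBlDl.
Qed.

End Path.

(** * Poisson events *)

Lemma poisson_prob_set1 (R : realType) (r : R) (k n : nat) : 0 <= r ->
  poisson_prob r k [set n] = (r ^+ n / n`!%:R * expR (- r))%:E.
Proof.
rewrite le_eqVlt /poisson_prob => /predU1P[<-|r_gt0].
  (* At rate 0 the law is the Dirac mass at 0, matched by [0 ^+ 0 = 1] on the right. *)
  rewrite ltxx diracE oppr0 expR0 mulr1 expr0n; case: n => [|n] /=.
    by rewrite mem_set// divr1.
  by rewrite memNset// mul0r.
rewrite r_gt0 esum_set1 ?lee_fin ?poisson_pmf_ge0//.
by rewrite /poisson_pmf r_gt0.
Qed.

Section Poisson.
Variables (R : realType) (d : measure_display) (Omega : measurableType d).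
Variables (P : probability Omega R) (r : R) (A : R -> Omega -> nat).
Hypotheses (r_ge0 : 0 <= r) (A_poisson : poisson_process P r A).

Lemma poisson_process_prob (t : R) (n : nat) : 0 <= t ->
  P (A t @^-1` [set n]) = ((r * t) ^+ n / n`!%:R * expR (- (r * t)))%:E.
Proof.
move=> t0; have := poisson_increment A_poisson [set n] (lexx 0) t0.
rewrite subr0 poisson_prob_set1 ?mulr_ge0// => <-; congr (P _).
by apply/funext => w; rewrite /preimage/= (poisson_start A_poisson) subn0.
Qed.

(** The event says [n] jumps on []0, s]] and none on []s, t]], and these increments are
    independent. *)
Lemma poisson_process_prob_constant (s t : R) (n : nat) : 0 <= s -> s <= t ->
  P (A s @^-1` [set n] `&` A t @^-1` [set n])
    = ((r * s) ^+ n / n`!%:R * expR (- (r * t)))%:E.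
Proof.
move=> s0 st; have t0 := le_trans s0 st.
(* The partition [0 <= s <= t], extended by the constant [t] to a nondecreasing sequence. *)
pose tm k : R := if k is k'.+1 then (if k' is 0%N then s else t) else 0.
have tm_nd : {homo tm : k l / (k <= l)%N >-> k <= l}.
  by move=> [|[|k]] [|[|l]].
pose E (k : 'I_2) := (fun w => A (tm k.+1) w - A (tm k) w)%N @^-1`
  [set if k == ord0 then n else 0%N].
have EE (k : 'I_2) : sigma_of_variable (fun w => A (tm k.+1) w - A (tm k) w)%N (E k).
  by exists [set if k == ord0 then n else 0%N] => //; rewrite setTI.
have := @poisson_independent_increments _ _ _ _ _ _ A_poisson 2 tm (lexx 0)
  tm_nd E EE.
rewrite big_ord_recl big_ord1 /E /=.
rewrite (poisson_increment A_poisson)// (poisson_increment A_poisson)//.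
rewrite !poisson_prob_set1 ?mulr_ge0// ?subr_ge0// subr0 /= expr0 divr1 mul1r.
have -> : expR (- (r * t)) = expR (- (r * s)) * expR (- (r * (t - s))).
  by rewrite -expRD; congr expR; ring.
rewrite mulrA => <-; congr (P _); apply/seteqP; split => w /=.
  move=> [As At] k _; have [->|/negbTE k0] := eqVneq k ord0.
    by rewrite /= (poisson_start A_poisson) As subn0.
  case: k k0 => -[|[|//]] //= _ _.
  by rewrite As At subnn.
move=> Ew; have /= := Ew ord0 I; rewrite (poisson_start A_poisson) subn0 => As.
split => //; have /= := Ew ord_max I; rewrite As => /eqP; rewrite subn_eq0 => Atn.
by apply/eqP; rewrite eqn_leq Atn -As (poisson_nondecreasing A_poisson).
Qed.

End Poisson.

(** Coordinates are measurable, so singletons are finite intersections of measurable sets, and the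
    space is countable. *)
Lemma tuple_nat_measurable (N : nat) (B : set (N.-tuple nat)) : measurable B.
Proof.
apply: countable_measurable; last exact: countableP.
move=> x; rewrite (_ : [set x] = \bigcap_(i in [set: 'I_N])
    ((fun y : N.-tuple nat => tnth y i) @^-1` [set tnth x i])).
  apply: fin_bigcap_measurable => // i _.
  by rewrite -[X in measurable X]setTI; exact: measurable_tnth.
apply/seteqP; split => y /=; first by move=> ->.
by move=> xy; apply: eq_from_tnth => i; exact: xy.
Qed.

Lemma tuple_nat_measurable_fun (N : nat) (d : measure_display)
    (T : measurableType d) (f : N.-tuple nat -> T) : measurable_fun setT f.
Proof. by move=> _ B mB; exact: tuple_nat_measurable. Qed.

(** This permits conditioning on a countable variable: the fibres of [Z] form a countable partition
    over which the integrals are summed. *)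
Lemma le_integral_fibers (R : realType) (d : measure_display)
    (Omega : measurableType d) (mu : {measure set Omega -> \bar R})
    (T : countType) (Z : Omega -> T) (f g : Omega -> \bar R) :
  (forall x, measurable (Z @^-1` [set x])) ->
  measurable_fun setT f -> measurable_fun setT g ->
  (forall w, 0 <= f w)%E -> (forall w, 0 <= g w)%E ->
  (forall x, \int[mu]_(w in Z @^-1` [set x]) f w
    <= \int[mu]_(w in Z @^-1` [set x]) g w)%E ->
  (\int[mu]_w f w <= \int[mu]_w g w)%E.
Proof.
move=> mZ mf mg f0 g0 fg.
(* Fibres are numbered by the code [pickle]; a number that codes no point gives the empty set. *)
pose F n := Z @^-1` [set x | pickle x = n].
have FE n : F n = set0 \/ exists x, F n = Z @^-1` [set x].
  case E: (@pickle_inv T n) => [x|]; [right; exists x|left].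
    have xn : pickle x = n by have := @pickle_invK T n; rewrite /oapp E.
    by apply/funext => w; apply/propext; rewrite /F /preimage/=; split => [|->//];
      rewrite -xn => /(pcan_inj pickleK).
  apply/seteqP; split => // w /= Zw; have := @pickleK_inv T (Z w).
  by rewrite Zw E.
have mF n : measurable (F n) by have [->//|[x ->]] := FE n.
have FT : [set: Omega] = \bigcup_n F n.
  by apply/seteqP; split => // w _; exists (pickle (Z w)).
have tF : trivIset setT F.
  apply/trivIsetP => i j _ _ /eqP ij; apply/seteqP; split; last by [].
  by move=> w [Zi Zj]; case: ij; rewrite -Zi -Zj.
rewrite FT !ge0_integral_bigcup//; try exact: measurable_funTS.
apply: lee_nneseries => [n _ _|n _]; first exact: integral_ge0.
by have [->|[x ->]] := FE n; rewrite ?integral_set0.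
Qed.

Lemma big_optionType (R : Type) (idx : R) (op : Monoid.law idx)
    (I : finType) (F : option I -> R) :
  \big[op/idx]_(i : option I) F i = op (F None) (\big[op/idx]_(i : I) F (Some i)).
Proof.
by rewrite ![index_enum _]unlock [@Finite.enum in LHS]unlock/= big_cons big_map.
Qed.

Lemma prod_expr_eq (R : comNzRingType) (I : finType) (F : I -> R) (i : I) :
  \prod_j F j ^+ (i == j) = F i.
Proof.
rewrite (bigD1 i)//= eqxx expr1 big1 ?mulr1// => j.
by rewrite eq_sym => /negbTE ->.
Qed.

(** * Jump events and their probabilities *)

Section Jumps.
Variables (R : realType) (N : nat) (lam : 'I_N -> R).
Variables (psi : N.-tuple nat -> 'rV[R]_N).

Definition arrival (x : N.-tuple nat) (i : 'I_N) : N.-tuple nat :=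
  [tuple (tnth x j + (j == i))%N | j < N].

(** Truncation makes a departure from an empty queue leave the state unchanged; the drift multiplies
    that value by a service rate that is then 0. *)
Definition departure (x : N.-tuple nat) (i : 'I_N) : N.-tuple nat :=
  [tuple (tnth x j - (j == i))%N | j < N].

Definition jump_target (x : N.-tuple nat) (k : option ('I_N + 'I_N)) :=
  match k with
  | None => x
  | Some (inl i) => arrival x i
  | Some (inr i) => departure x i
  end.

(** The probability of each jump case given [X 0 = x]. For a jump the service drivers are controlled
    up to time [t] itself, whence the rate 1 in the exponent; only the first order in [t] matters
    there. *)
Definition jump_prob (x : N.-tuple nat) (t : R) (k : option ('I_N + 'I_N)) : R :=
  match k with
  | None => expR (- ((\sum_i (lam i + psi x ord0 i)) * t))
  | Some (inl i) => lam i * t * expR (- ((\sum_i (lam i + 1)) * t))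
  | Some (inr i) => psi x ord0 i * t * expR (- ((\sum_i (lam i + 1)) * t))
  end.

Variables (d : measure_display) (Omega : measurableType d).
Variables (P : probability Omega R) (A S : 'I_N -> R -> Omega -> nat).
Variable X : R -> Omega -> N.-tuple nat.

(* The case [k] of exactly one arrival, exactly one departure or no jump before
   time [t], described by the independent drivers alone.  A silent trajectory
   only needs the departure clocks to be silent up to [psi x * t]. *)
Definition jump_event (x : N.-tuple nat) (t : R)
    (k l : option ('I_N + 'I_N)) : set Omega :=
  match l with
  | None => X 0 @^-1` [set x]
  | Some (inl j) => A j t @^-1` [set (k == Some (inl j)) : nat]
  | Some (inr j) =>
      S j (psi x ord0 j * t) @^-1` [set (k == Some (inr j)) : nat] `&`
      S j (if k is None then psi x ord0 j * t else t)
        @^-1` [set (k == Some (inr j)) : nat]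
  end.

Hypothesis lam_ge0 : forall i, 0 <= lam i.
Hypothesis psi_bounds : forall x i, 0 <= psi x ord0 i /\ psi x ord0 i <= 1.
Hypothesis network : network_process lam psi P A S X.

Let psi_ge0 x i : 0 <= psi x ord0 i. Proof. by case: (psi_bounds x i). Qed.
Let psi_le1 x i : psi x ord0 i <= 1. Proof. by case: (psi_bounds x i). Qed.

Let psi_time x i (t : R) : 0 <= t -> 0 <= psi x ord0 i * t <= t.
Proof. by move=> t0; rewrite mulr_ge0//= ler_piMl. Qed.

Lemma jump_eventE x t k w :
  (\bigcap_(l in [set: option ('I_N + 'I_N)]) jump_event x t k l) w ->
  [/\ X 0 w = x, forall j, A j t w = (k == Some (inl j)),
      forall j, S j (psi x ord0 j * t) w = (k == Some (inr j)) &
      k != None -> forall j, S j t w = (k == Some (inr j))].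
Proof.
move=> E; split; first exact: (E None I).
- by move=> j; exact: (E (Some (inl j)) I).
- by move=> j; have [] := E (Some (inr j)) I.
- by move=> k0 j; have [_] := E (Some (inr j)) I; case: k k0 {E}.
Qed.

(** For a fixed initial state the events are disjoint, because the driver counts at times
    independent of [k] identify [k]. *)
Lemma jump_event_inj x t k k' w :
  (\bigcap_(l in [set: option ('I_N + 'I_N)]) jump_event x t k l) w ->
  (\bigcap_(l in [set: option ('I_N + 'I_N)]) jump_event x t k' l) w ->
  k = k'.
Proof.
move=> /jump_eventE[_ Ak Sk _] /jump_eventE[_ Ak' Sk' _].
have ee l : (k == Some l) = (k' == Some l).
  case: l => j; apply: (can_inj oddb); first by rewrite -Ak -Ak'.
  by rewrite -Sk -Sk'.
case: k k' ee {Ak Sk Ak' Sk'} => [l|] [l'|] // ee.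
- by have := ee l; rewrite eqxx => /esym/eqP ->.
- by have := ee l; rewrite eqxx.
- by have := ee l'; rewrite eqxx.
Qed.

(** The balance equation holds for all times outside one null set, which therefore does not depend
    on [x] or [k]; off it the trajectory lemmas determine the state. *)
Lemma jump_event_target (t : R) : 0 <= t -> \forall w \ae P, forall x k,
  (\bigcap_(l in [set: option ('I_N + 'I_N)]) jump_event x t k l) w ->
  X t w = jump_target x k.
Proof.
move=> t0; apply: filterS (network_evolution network) => w evo x k.
move=> /jump_eventE[X0 At Spsi St].
have nA i (s u : R) : 0 <= s -> s <= u -> (A i s w <= A i u w)%N.
  exact: (poisson_nondecreasing (network_arrivals network i)).
have nS i (s u : R) : 0 <= s -> s <= u -> (S i s w <= S i u w)%N.
  exact: (poisson_nondecreasing (network_services network i)).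
have rS i (s : R) : 0 <= s -> \forall u \near s^'+, S i u w = S i s w.
  exact: (poisson_right_continuous (network_services network i)).
have evo' (s : R) i : 0 <= s -> (tnth (X s w) i +
    S i (clock (fun u => psi (X u w) ord0 i) s) w = tnth (X 0 w) i + A i s w)%N.
  by move=> s0; exact: evo.
case: k At Spsi St => [[i|i]|] /= At Spsi St.
- apply: eq_from_tnth => j; rewrite tnth_mktuple.
  rewrite (path_without_service (X := fun s => X s w) (S := fun i s => S i s w)
    (A := fun i s => A i s w) psi_bounds nS evo' t0); last by rewrite St.
  by rewrite X0 At eq_sym.
- apply: eq_from_tnth => j; rewrite tnth_mktuple.
  have := @path_one_departure _ _ _ (fun s => X s w) (fun i s => A i s w)
    (fun i s => S i s w) psi_bounds nA nS evo' t i t0.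
  rewrite X0 => <- //; first by rewrite addnK.
    by move=> k; rewrite St// eq_sym.
  by rewrite Spsi eqxx.
- have := @path_silent _ _ _ (fun s => X s w) (fun i s => A i s w)
    (fun i s => S i s w) psi_bounds nA nS rS evo' t t0.
  by rewrite X0; apply.
Qed.

Lemma network_measurable_preimage (t : R) (B : set (N.-tuple nat)) : 0 <= t ->
  measurable (X t @^-1` B).
Proof.
move=> t0; rewrite -[X in measurable X]setTI.
by apply: (network_measurable network t0) => //; exact: tuple_nat_measurable.
Qed.

Let measurable_poisson r (B : R -> Omega -> nat) (t : R) (U : set nat) :
  poisson_process P r B -> 0 <= t -> measurable (B t @^-1` U).
Proof.
move=> PB t0; rewrite -[X in measurable X]setTI.
exact: (poisson_measurable PB t0).
Qed.

Lemma measurable_jump_event x (t : R) k l : 0 <= t ->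
  measurable (jump_event x t k l).
Proof.
move=> t0; have psi_t j := andP (psi_time x j t0).
case: l => [[j|j]|] /=; last exact: network_measurable_preimage.
  exact: (measurable_poisson _ (network_arrivals network j)).
apply: measurableI;
  apply: (measurable_poisson _ (network_services network j)).
  by case: (psi_t j).
by case: k => // ; case: (psi_t j).
Qed.

Lemma sigma_of_process_mem (B : R -> Omega -> nat) (t : R) (U : set nat) :
  0 <= t -> sigma_of_process B (B t @^-1` U).
Proof.
move=> t0; apply: sub_gen_smallest; exists t => //.
by exists U => //; rewrite setTI.
Qed.

(** Independence of the drivers and the initial state gives a product of exponentials; the driver
    that must jump, if any, contributes one further factor linear in [t]. *)
Lemma jump_event_prob x (t : R) k : 0 <= t ->
  P (\bigcap_(l in [set: option ('I_N + 'I_N)]) jump_event x t k l)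
    = ((jump_prob x t k)%:E * P (X 0 @^-1` [set x]))%E.
Proof.
move=> t0; have psi_t j := andP (psi_time x j t0).
rewrite (network_independent network); last first.
  case=> [[j|j]|] /=.
  - exact: sigma_of_process_mem.
  - apply: (@measurableI _ (g_sigma_algebraType _)).
      by apply: sigma_of_process_mem; case: (psi_t j).
    by apply: sigma_of_process_mem; case: (k) => //; case: (psi_t j).
  - by exists [set x]; [exact: tuple_nat_measurable | rewrite setTI].
rewrite big_optionType big_sumType /=.
(* A count of 0 or 1 serves as the exponent, and its factorial is 1. *)
have A_prob j : fine (P (A j t @^-1` [set (k == Some (inl j)) : nat])) =
    (lam j * t) ^+ (k == Some (inl j)) * expR (- (lam j * t)).
  rewrite (poisson_process_prob (lam_ge0 j) (network_arrivals network j))//=.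
  by case: (_ == _); rewrite divr1.
have S_prob j : fine (P (jump_event x t k (Some (inr j)))) =
    (psi x ord0 j * t) ^+ (k == Some (inr j)) *
      expR (- (if k is None then psi x ord0 j * t else t)).
  rewrite /= (poisson_process_prob_constant ler01 (network_services network j)).
  - by rewrite !mul1r; case: (_ == _); rewrite divr1.
  - by case: (psi_t j).
  - by case: (k) => //; case: (psi_t j).
under eq_bigr do rewrite A_prob.
under [X in (_ * (_ * X))%R]eq_bigr do rewrite S_prob.
rewrite !big_split/= -!expR_sum mulrC EFinM fineK ?fin_num_measure//; last first.
  exact: network_measurable_preimage.
congr (_%:E * _)%E; rewrite mulrACA -expRD.
have rates : \sum_i - (lam i * t) + \sum_(i < N) - t =
    - ((\sum_i (lam i + 1)) * t).
  rewrite -big_split/= mulr_suml -sumrN; apply: eq_bigr => i _; ring.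
case: k {A_prob S_prob} => [[i|i]|] /=.
- by rewrite rates prod_expr_eq big1 ?mulr1.
- by rewrite rates [X in X * _ * _]big1// mul1r prod_expr_eq.
- rewrite [X in X * _ * _]big1// [X in _ * X * _]big1// !mul1r -big_split/=.
  rewrite mulr_suml -sumrN; congr expR; apply: eq_bigr => i _; ring.
Qed.

End Jumps.

(** * The generator inequality *)

Lemma ge0_integral_law (R : realType) (N : nat) (d : measure_display)
    (Omega : measurableType d) (P : probability Omega R)
    (pi : probability (N.-tuple nat) R) (Z : Omega -> N.-tuple nat)
    (f : N.-tuple nat -> \bar R) :
  measurable_fun setT Z ->
  (forall B : set (N.-tuple nat), measurable B -> P (Z @^-1` B) = pi B) ->
  (forall x, 0 <= f x)%E -> (\int[P]_w f (Z w) = \int[pi]_x f x)%E.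
Proof.
move=> mZ Zpi f0.
rewrite -[LHS](@ge0_integral_pushforward _ _ _ _ _ _ mZ P setT)//.
- by apply: eq_measure_integral => B mB _; exact: Zpi.
- exact: tuple_nat_measurable_fun.
Qed.

Lemma integral_cst_probability (d : measure_display) (T : measurableType d)
    (R : realType) (P : probability T R) (r : \bar R) :
  (\int[P]_x cst r x)%E = r.
Proof. by rewrite integral_cst//= probability_setT mule1. Qed.

Section Generator.
Variables (R : realType) (N : nat) (lam : 'I_N -> R).
Variables (psi : N.-tuple nat -> 'rV[R]_N) (pi : probability (N.-tuple nat) R).
Hypothesis lam_ge0 : forall i, 0 <= lam i.
Hypothesis psi_bounds : forall x i, 0 <= psi x ord0 i /\ psi x ord0 i <= 1.
Hypothesis pi_stationary : stationary_distribution lam psi pi.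
Variable c : N.-tuple nat -> R.
Hypothesis c_ge0 : forall x, 0 <= c x.

Let psi_ge0 x i : 0 <= psi x ord0 i. Proof. by case: (psi_bounds x i). Qed.
Let psi_le1 x i : psi x ord0 i <= 1. Proof. by case: (psi_bounds x i). Qed.

Lemma jump_prob_ge0 x (t : R) k : 0 <= t -> 0 <= jump_prob lam psi x t k.
Proof.
by move=> t0; case: k => [[i|i]|] /=; rewrite ?expR_ge0// !mulr_ge0 ?expR_ge0.
Qed.

(** Given [X 0 = x], the disjoint jump events send the state to known targets. What happens outside
    them contributes nonnegatively to the mean of [c] at time [t], and by stationarity that mean is
    the right-hand side. *)
Lemma stationary_jumps (t : R) : 0 <= t ->
  (\int[pi]_x (\sum_k jump_prob lam psi x t k * c (jump_target x k))%:E
    <= \int[pi]_x (c x)%:E)%E.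
Proof.
move=> t0.
case: pi_stationary => d [ Omega [P [A [S [X [network X_pi]]]]]].
pose F x : R := \sum_k jump_prob lam psi x t k * c (jump_target x k).
have F_ge0 x : 0 <= F x.
  by apply: sumr_ge0 => k _; rewrite mulr_ge0// jump_prob_ge0.
rewrite -(ge0_integral_law (network_measurable network (lexx 0))
  (fun B => X_pi 0 B (lexx 0))); last by move=> x; rewrite lee_fin F_ge0.
rewrite -(ge0_integral_law (network_measurable network t0)
  (fun B => X_pi t B t0)); last by move=> x; rewrite lee_fin.
have mcomp (s : R) (f : N.-tuple nat -> R) : 0 <= s ->
    measurable_fun setT (fun w => (f (X s w))%:E).
  move=> s0; apply: (@measurableT_comp _ _ _ _ _ _ (fun x => (f x)%:E)).
    exact: tuple_nat_measurable_fun.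
  exact: network_measurable network _ s0.
apply: (@le_integral_fibers _ _ _ _ _ (X 0)).
- move=> x; exact: (network_measurable_preimage network).
- exact: (mcomp 0 F).
- exact: mcomp.
- by move=> w; rewrite lee_fin F_ge0.
- by move=> w; rewrite lee_fin.
move=> x; set D := X 0 @^-1` [set x].
have mD : measurable D by exact: (network_measurable_preimage network).
pose E k := \bigcap_(l in [set: option ('I_N + 'I_N)])
  jump_event psi A S X x t k l.
have mE k : measurable (E k).
  apply: fin_bigcap_measurable => // l _.
  exact: (measurable_jump_event psi_bounds network).
have ED k : E k `&` D = E k by apply: setIidl => w /(_ None I).
(* At most one indicator is nonzero, and almost surely its coefficient is then [c (X t w)]. *)
apply: (@le_trans _ _ (\int[P]_(w in D)
    (\sum_k (c (jump_target x k))%:E * (\1_(E k) w)%:E))%E); last first.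
  apply: ae_ge0_le_integral => //.
  - by move=> w _; apply: sume_ge0 => k _; rewrite mule_ge0// lee_fin.
  - apply: emeasurable_sum => k; apply: measurable_funeM.
    by apply/measurable_EFinP; exact: measurable_indic.
  - by move=> w _; rewrite lee_fin.
  - by apply: measurable_funTS; exact: mcomp.
  - apply: filterS (jump_event_target psi_bounds network t0) => w Xw _.
    have [[k Ek]|noE] := pselect (exists k, E k w).
      rewrite (bigD1 k)//= big1 ?adde0; last first.
        move=> k' /eqP k'k; rewrite indicE memNset ?mule0// => Ek'.
        exact/k'k/(jump_event_inj Ek' Ek).
      by rewrite indicE mem_set// mule1 (Xw x k).
    rewrite big1 ?lee_fin// => k _; rewrite indicE memNset ?mule0// => Ek.
    by apply: noE; exists k.
rewrite ge0_integral_sum//; last 2 first.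
- move=> k; apply: measurable_funeM.
  by apply/measurable_EFinP; exact: measurable_indic.
- by move=> k w _; rewrite mule_ge0// lee_fin.
rewrite (eq_integral (cst (F x)%:E)); last by move=> w; rewrite inE => ->.
rewrite integral_cst// -sumEFin ge0_sume_distrl; last first.
  by move=> k _; rewrite lee_fin mulr_ge0// jump_prob_ge0.
apply: lee_sum => k _; rewrite ge0_integralZl//; last 2 first.
- by apply/measurable_EFinP; exact: measurable_indic.
- by rewrite lee_fin.
rewrite integral_indic// ED /E [X in (_ <= _ * X)%E](jump_event_prob lam_ge0
  psi_bounds network x k t0).
by rewrite muleA -EFinM mulrC.
Qed.

Lemma integral_bounded_fin (f : N.-tuple nat -> R) (M : R) :
  (forall x, 0 <= f x <= M) -> (\int[pi]_x (f x)%:E)%E \is a fin_num.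
Proof.
move=> fM; rewrite ge0_fin_numE; last first.
  by apply: integral_ge0 => x _; rewrite lee_fin; case/andP: (fM x).
apply: (@le_lt_trans _ _ (\int[pi]_x (cst M%:E) x)%E).
  apply: ge0_le_integral_nonmeasurable => x _; rewrite lee_fin;
    by case/andP: (fM x).
by rewrite integral_cst_probability ltry.
Qed.

(** [stationary_jumps] is expanded to first order in [t], divided by [t], and [t] tends to 0.
    Boundedness of [c] makes the integrals finite, so the zeroth-order term cancels. *)
Lemma stationary_generator (M : R) : (forall x, c x <= M) ->
  (\int[pi]_x (\sum_i (lam i * c (arrival x i)
                       + psi x ord0 i * c (departure x i)))%:E
    <= \int[pi]_x ((\sum_i (lam i + psi x ord0 i)) * c x)%:E)%E.
Proof.
move=> cM.
have M_ge0 : 0 <= M by exact: le_trans (c_ge0 [tuple 0%N | _ < N]) (cM _).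
pose L : R := \sum_i (lam i + 1).
pose q x : R := \sum_i (lam i + psi x ord0 i).
pose B x : R := \sum_i (lam i * c (arrival x i)
                        + psi x ord0 i * c (departure x i)).
have L_ge0 : 0 <= L by apply: sumr_ge0 => i _; rewrite addr_ge0.
have q_ge0 x : 0 <= q x by apply: sumr_ge0 => i _; rewrite addr_ge0.
have q_le x : q x <= L by apply: ler_sum => i _; rewrite lerD2l.
have B_ge0 x : 0 <= B x.
  by apply: sumr_ge0 => i _; rewrite addr_ge0// mulr_ge0.
have B_le x : B x <= L * M.
  rewrite mulr_suml; apply: ler_sum => i _; rewrite mulrDl lerD//.
    exact: ler_wpM2l.
  exact: ler_pM.
rewrite -/(\int[pi]_x (B x)%:E)%E -/(\int[pi]_x (q x * c x)%:E)%E.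
have fB : (\int[pi]_x (B x)%:E)%E \is a fin_num.
  by apply: (@integral_bounded_fin _ (L * M)) => x; rewrite B_ge0 B_le.
have fq : (\int[pi]_x (q x * c x)%:E)%E \is a fin_num.
  apply: (@integral_bounded_fin _ (L * M)) => x.
  by rewrite mulr_ge0//= ler_pM.
have fc : (\int[pi]_x (c x)%:E)%E \is a fin_num.
  by apply: (@integral_bounded_fin _ M) => x; rewrite c_ge0 cM.
have meas (f : N.-tuple nat -> \bar R) : measurable_fun setT f.
  exact: tuple_nat_measurable_fun.
(* The error comes from [expR (- (L * t)) >= 1 - L * t] applied to the jump terms, where
   [B x <= L * M]. *)
have key (t : R) : 0 < t ->
    (\int[pi]_x (B x)%:E <= \int[pi]_x (q x * c x)%:E + (t * (L * (L * M)))%:E)%E.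
  move=> t_gt0; have t0 := ltW t_gt0.
  pose F x : R := \sum_k jump_prob lam psi x t k * c (jump_target x k).
  have F_ge0 x : 0 <= F x.
    by apply: sumr_ge0 => k _; rewrite mulr_ge0// jump_prob_ge0.
  have FE x : F x = expR (- (q x * t)) * c x + t * expR (- (L * t)) * B x.
    rewrite /F big_optionType big_sumType/= -big_split/= mulr_sumr.
    congr (_ + _); apply: eq_bigr => i _; rewrite -/L; ring.
  have le_F x : c x + t * B x <= F x + (t * (q x * c x) + t * (t * (L * (L * M)))).
    have e1 := expR_ge1Dx (- (q x * t)).
    have e2 := expR_ge1Dx (- (L * t)).
    have e3 : (1 - q x * t) * c x <= expR (- (q x * t)) * c x.
      exact: ler_wpM2r.
    have e4 : t * (1 - L * t) * B x <= t * expR (- (L * t)) * B x.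
      by rewrite ler_wpM2r// ler_wpM2l.
    have e5 : t * t * L * B x <= t * t * L * (L * M).
      by rewrite ler_wpM2l// !mulr_ge0.
    rewrite FE; lra.
  have K_ge0 : 0 <= t * (t * (L * (L * M))) by rewrite !mulr_ge0.
  have int_le : (\int[pi]_x (c x)%:E + t%:E * \int[pi]_x (B x)%:E <=
      \int[pi]_x (c x)%:E + (t%:E * \int[pi]_x (q x * c x)%:E
        + (t * (t * (L * (L * M))))%:E))%E.
    rewrite -ge0_integralZl//; last by move=> x _; rewrite lee_fin.
    rewrite -ge0_integralZl//; last by move=> x _; rewrite lee_fin mulr_ge0.
    rewrite -ge0_integralD//; last 2 first.
    - by move=> x _; rewrite lee_fin.
    - by move=> x _; rewrite mule_ge0// lee_fin.
    apply: (@le_trans _ _ (\int[pi]_x ((F x)%:E + (t%:E * (q x * c x)%:E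
        + (cst (t * (t * (L * (L * M))))%:E) x)))%E).
      apply: ge0_le_integral_nonmeasurable => x _.
        by rewrite -EFinM -EFinD lee_fin addr_ge0// mulr_ge0.
      by rewrite /= -!EFinM -!EFinD lee_fin.
    rewrite ge0_integralD//; last 2 first.
    - by move=> x _; rewrite lee_fin.
    - by move=> x _; rewrite -EFinM -EFinD lee_fin addr_ge0// !mulr_ge0.
    rewrite ge0_integralD//; last first.
      by move=> x _; rewrite -EFinM lee_fin !mulr_ge0.
    rewrite integral_cst_probability leeD2r//.
    exact: stationary_jumps.
  move: int_le; rewrite leeD2lE//.
  rewrite -(fineK fB) -(fineK fq) -!EFinM -!EFinD !lee_fin -mulrDr.
  by rewrite ler_pM2l.
rewrite -(fineK fB) -(fineK fq) lee_fin; apply/ler_addgt0Pr => e e_gt0.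
(* Adding 1 keeps the divisor positive when the error constant is 0; the resulting [t] makes the
   error at most [e]. *)
have K_gt0 : 0 < L * (L * M) + 1 by rewrite ltr_wpDl// !mulr_ge0.
have := key (e / (L * (L * M) + 1)) (divr_gt0 e_gt0 K_gt0).
rewrite -(fineK fB) -(fineK fq) -EFinD lee_fin => /le_trans; apply.
rewrite lerD2l mulrAC ler_pdivrMr// ler_wpM2l ?ltW//.
by rewrite ltrDl.
Qed.

End Generator.

(** * The drift of the potential *)

Section Utility.
Variables (R : realType) (h : R -> \bar R).
Hypothesis h_utility : utility h.

Lemma utility_lty (y : R) : 0 <= y -> (h y < +oo)%E.
Proof.
move=> y0; apply: lt_le_trans (leey (h (y + 1))).
by apply: (utility_increasing h_utility) => //; rewrite ltrDl.
Qed.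

Lemma utility_EFin (y : R) : 0 < y -> h y = (fine (h y))%:E.
Proof. by move=> /(utility_fin h_utility)/fineK. Qed.

(** By concavity the difference quotients along the segment from [v] to [y] dominate [h y - h v],
    and they tend to the derivative times [y - v] as the segment shrinks. If [h y] is [-oo] the
    bound is trivial. *)
Lemma utility_tangent (y v : R) : 0 <= y -> 0 < v ->
  (h y <= (fine (h v) + utility_deriv h v * (y - v))%:E)%E.
Proof.
move=> y0 v0.
case hy: (h y) (utility_lty y0) => [a| |] // _; last by rewrite leNye.
rewrite lee_fin -lerBlDl.
have [vy|yv] := eqVneq v y; first by rewrite vy hy /= !subrr mulr0.
have chord (p : R) : 0 < p -> p <= 1 ->
    a - fine (h v) <= p^-1 * (fine (h (p * (y - v) + v)) - fine (h v)).
  move=> p0 p1; rewrite ler_pdivlMl//.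
  have := utility_concave h_utility y0 (ltW v0) (ltW p0) p1.
  rewrite hy (utility_EFin v0).
  have -> : p * y + (1 - p) * v = p * (y - v) + v by ring.
  (* For [p < 1] the intermediate point is positive, so [h] is finite there; at [p = 1] it is [y],
     which may be 0. *)
  have [p1'|p1'] := eqVneq p 1.
    rewrite p1' !mul1r subrr mul0e adde0 mul1e subrK hy /= => _; lra.
  have q_gt0 : 0 < p * (y - v) + v.
    have : 0 < (1 - p) * v by rewrite mulr_gt0// subr_gt0 lt_neqAle p1' p1.
    have : 0 <= p * y by rewrite mulr_ge0// ltW.
    lra.
  rewrite (utility_EFin q_gt0) -!EFinM -EFinD lee_fin; lra.
apply/ler_addgt0Pr => e e_gt0.
have dv : 0 < `|y - v| by rewrite normr_gt0 subr_eq0 eq_sym.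
have := utility_differentiable h_utility v0.
rewrite /derivable => /cvg_ex[l hl].
have lE : utility_deriv h v = l.
  by rewrite /utility_deriv derive1E; apply/cvg_lim.
move/cvgrPdist_lt : hl => /(_ (e / `|y - v|) (divr_gt0 e_gt0 dv)).
move=> [r /= r_gt0 hr].
(* Small enough for [p * (y - v)] to lie strictly within the radius [r], and at most 1 for the chord
   bound. *)
pose p := Num.min 1 (r / `|y - v| / 2).
have p0 : 0 < p by rewrite lt_min ltr01 !divr_gt0.
have p1 : p <= 1 by rewrite ge_min lexx.
have pr : p * `|y - v| < r.
  rewrite -ltr_pdivlMr//; apply: (@le_lt_trans _ _ (r / `|y - v| / 2)).
    by rewrite ge_min lexx orbT.
  by rewrite ltr_pdivrMr// ltr_pMr ?divr_gt0// ltr1n.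
have pyv : p * (y - v) != 0 by rewrite mulf_eq0 negb_or (gt_eqF p0) subr_eq0 eq_sym.
have := hr (p * (y - v)).
rewrite /= sub0r normrN normrM (gtr0_norm p0) => /(_ pr pyv).
rewrite lE /GRing.scale/= mulr1 => quot.
apply: (le_trans (chord p p0 p1)).
set D := fine _ - fine _ in quot *.
have -> : p^-1 * D = (y - v) * ((p * (y - v))^-1 * D).
  by rewrite invfM mulrA mulrCA divff ?mulr1// subr_eq0 eq_sym.
set Q := _^-1 * D in quot *.
rewrite -lerBlDl [l * _]mulrC -mulrBr.
apply: le_trans (ler_norm _) _; rewrite normrM.
by rewrite mulrC -ler_pdivlMr// distrC ltW.
Qed.

(** The strict growth of [h] from [v] to [v + v] is at most that of the tangent, which is the slope
    times [v]. *)
Lemma utility_deriv_gt0 (v : R) : 0 < v -> 0 < utility_deriv h v.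
Proof.
move=> v0.
have v2 : v < v + v by rewrite ltrDl.
have v20 : 0 < v + v by exact: addr_gt0.
have := utility_increasing h_utility (ltW v0) v2.
have := utility_tangent (ltW v20) v0.
rewrite (utility_EFin v20) (utility_EFin v0) lee_fin lte_fin /= addrK => ht hi.
have := lt_le_trans hi ht; rewrite ltrDl.
by rewrite pmulr_lgt0.
Qed.

End Utility.

(** * Optimality of the service rates and the resulting drift *)

Section Drift.
Variables (R : realType) (N : nat) (lam : 'I_N -> R) (C : set 'rV[R]_N).
Variables (h : R -> \bar R) (g : nat -> R) (psi : N.-tuple nat -> 'rV[R]_N).
Variables (nu : 'rV[R]_N) (eps : R).
Hypotheses (lam_ge0 : forall i, 0 <= lam i) (h_utility : utility h).
Hypotheses (g_weight : weight g) (psi_service : service_rates C h g psi).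
Hypotheses (nu_C : C nu) (eps_gt0 : 0 < eps).
Hypothesis lam_nu : forall i, lam i < nu ord0 i - eps.

Let psi_ge0 x i : 0 <= psi x ord0 i.
Proof. by case: (service_bounds psi_service x i). Qed.

Let nu_gt0 i : 0 < nu ord0 i.
Proof. by have := eps_gt0; have := lam_ge0 i; have := lam_nu i; lra. Qed.

Let objective_nu x : objective h g x nu =
  (\sum_(i < N) g (tnth x i) * fine (h (nu ord0 i)))%:E.
Proof.
rewrite /objective -sumEFin; apply: eq_bigr => i _.
by rewrite (utility_EFin h_utility (nu_gt0 i)).
Qed.

(* At the empty state [psi] vanishes, and it could not maximise the objective
   against [nu > 0] if [g 0] were positive. *)
Lemma weight_at0 (i : 'I_N) : g 0 = 0.
Proof.
apply/eqP; rewrite eq_le (weight_ge0 g_weight) andbT leNgt; apply/negP => g0.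
pose x : N.-tuple nat := [tuple 0%N | j < N].
have := service_argmax psi_service x nu_C; rewrite objective_nu.
rewrite /objective; under [leRHS]eq_bigr => j _.
  rewrite (service_empty psi_service) ?tnth_mktuple//; over.
case h0: (h 0) (utility_lty h_utility (lexx 0)) => [a| |] // _.
- under [leRHS]eq_bigr do rewrite -EFinM.
  rewrite sumEFin lee_fin leNgt => /negP; apply.
  have lt_h j : a < fine (h (nu ord0 j)).
    rewrite -lte_fin -h0 -(utility_EFin h_utility (nu_gt0 j)).
    exact: utility_increasing.
  rewrite (bigD1 i)//= [ltRHS](bigD1 i)//= tnth_mktuple ltr_leD//.
    by rewrite ltr_pM2l.
  by apply: ler_sum => j _; rewrite tnth_mktuple ler_wpM2l// ltW.
- by rewrite [leRHS](bigD1 i)//= gt0_muleNy ?lte_fin// addNye.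
Qed.

(** With a single customer, in queue [i], [g 0 = 0] leaves only that queue in the objective, so the
    optimum cannot serve it more slowly than [nu]. *)
Lemma rate_le_service (i : 'I_N) :
  nu ord0 i <= psi [tuple (j == i) : nat | j < N] ord0 i.
Proof.
set x := mktuple _; have g0 := weight_at0 i.
have objE mu : objective h g x mu = ((g 1)%:E * h (mu ord0 i))%E.
  rewrite /objective (bigD1 i)//= tnth_mktuple eqxx big1 ?adde0// => j ji.
  by rewrite tnth_mktuple (negbTE ji) g0 mul0e.
have := service_argmax psi_service x nu_C; rewrite !objE.
rewrite lee_pmul2l//; last first.
  by rewrite lte_fin -g0 (weight_increasing g_weight).
by apply: contraTT; rewrite -!ltNge; exact: utility_increasing.
Qed.

(** Service rates are at most 1, in particular in the one-customer state. The bound absorbs the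
    factor [lam i] in front of the increments of [g] in the drift. *)
Lemma arrival_rate_le1 i : lam i <= 1.
Proof.
have := eps_gt0; have := rate_le_service i; have := lam_nu i.
by have [_] := service_bounds psi_service [tuple (j == i) : nat | j < N] i; lra.
Qed.

Let w i := utility_deriv h (nu ord0 i).

Let w_ge0 i : 0 <= w i. Proof. exact/ltW/utility_deriv_gt0. Qed.

(** The tangents of [h] at the [nu ord0 i] bound the objective of [psi x] above and are exact at
    [nu], so optimality passes to the linearised objective. *)
Lemma service_argmax_linear x :
  \sum_i w i * g (tnth x i) * nu ord0 i <= \sum_i w i * g (tnth x i) * psi x ord0 i.
Proof.
have := service_argmax psi_service x nu_C; rewrite objective_nu.
have le_tangent : (objective h g x (psi x) <= (\sum_i g (tnth x i) *
    (fine (h (nu ord0 i)) + w i * (psi x ord0 i - nu ord0 i)))%:E)%E.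
  rewrite -sumEFin; apply: lee_sum => i _; rewrite EFinM lee_wpmul2l//.
    by rewrite lee_fin (weight_ge0 g_weight).
  exact: utility_tangent.
move=> /le_trans/(_ le_tangent); rewrite lee_fin -subr_ge0 -sumrB => le_sum.
rewrite -subr_ge0 -sumrB; apply: le_trans le_sum _; apply: ler_sum => i _; lra.
Qed.

(** A discrete primitive of [g], shifted so that a departure from queue [i] lowers it by exactly
    [w i * g (tnth x i)]; increments of [g] then come from arrivals only. *)
Definition potential (x : N.-tuple nat) : R :=
  \sum_i utility_deriv h (nu ord0 i) * \sum_(k < tnth x i) g k.+1.

Lemma potential_ge0 x : 0 <= potential x.
Proof.
apply: sumr_ge0 => i _; apply: mulr_ge0; first exact: w_ge0.
by apply: sumr_ge0 => k _; exact: weight_ge0.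
Qed.

Lemma potential_arrival x i :
  potential (arrival x i) = potential x + w i * g (tnth x i).+1.
Proof.
rewrite /potential (bigD1 i)//= [in RHS](bigD1 i)//= tnth_mktuple eqxx addn1.
rewrite big_ord_recr/= mulrDr addrAC; congr (_ + _ + _).
by apply: eq_bigr => j ji; rewrite tnth_mktuple (negbTE ji) addn0.
Qed.

Lemma potential_departure x i : (0 < tnth x i)%N ->
  potential (departure x i) = potential x - w i * g (tnth x i).
Proof.
move=> xi; have -> : potential x = potential (arrival (departure x i) i).
  congr potential; apply: eq_from_tnth => j; rewrite !tnth_mktuple.
  by case: eqVneq => [->|_] /=; rewrite ?subnK ?subn0 ?addn0.
by rewrite potential_arrival tnth_mktuple eqxx subn1 prednK// addrK.
Qed.

(** Where [potential x <= n] the truncation is inactive at [x] and can only raise [c] at the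
    neighbours, so the drift bound of [potential] survives. *)
Lemma truncated_drift (n : R) x : let c y := Num.max (n - potential y) 0 in
  potential x <= n ->
  (\sum_i (lam i + psi x ord0 i)) * c x + eps * \sum_i w i * g (tnth x i)
  <= \sum_i (lam i * c (arrival x i) + psi x ord0 i * c (departure x i))
     + \sum_i w i * increment g (tnth x i).
Proof.
move=> c xn.
have cE : c x = n - potential x by rewrite /c max_l// subr_ge0.
have c_ge y : n - potential y <= c y by rewrite /c le_max lexx.
have g_ge0 k : 0 <= g k := weight_ge0 g_weight k.
have term i : (lam i + psi x ord0 i) * c x
    + w i * g (tnth x i) * (psi x ord0 i - lam i)
    <= lam i * c (arrival x i) + psi x ord0 i * c (departure x i)
       + w i * increment g (tnth x i).
  have arr : lam i * (c x - w i * g (tnth x i).+1) <= lam i * c (arrival x i).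
    rewrite ler_wpM2l//; apply: le_trans (c_ge _).
    by rewrite cE potential_arrival; lra.
  have dep : psi x ord0 i * (c x + w i * g (tnth x i))
      <= psi x ord0 i * c (departure x i).
    have [xi|xi] := posnP (tnth x i).
      by rewrite (service_empty psi_service xi) !mul0r.
    rewrite ler_wpM2l//; apply: le_trans (c_ge _).
    by rewrite cE potential_departure//; lra.
  have incr : lam i * (w i * increment g (tnth x i)) <= w i * increment g (tnth x i).
    rewrite ler_piMl ?arrival_rate_le1// mulr_ge0// subr_ge0 ltW//.
    exact: weight_increasing g_weight _ _ _.
  by rewrite /increment in incr *; lra.
rewrite mulr_suml mulr_sumr -!big_split/=.
apply: le_trans (ler_sum _ (fun i _ => term i)).
rewrite !big_split/= lerD2l.
have := service_argmax_linear x.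
(* The slack [nu ord0 i - lam i > eps] in each queue produces the factor [eps]. *)
have : eps * (\sum_i w i * g (tnth x i)) <=
    \sum_i w i * g (tnth x i) * nu ord0 i - \sum_i w i * g (tnth x i) * lam i.
  rewrite mulr_sumr -sumrB; apply: ler_sum => i _.
  rewrite -mulrBr mulrC ler_wpM2l ?mulr_ge0//.
  by have := lam_nu i; lra.
rewrite -mulr_sumr (eq_bigr _ (fun i _ => mulrBr _ _ _)) sumrB; lra.
Qed.

End Drift.

(** * The moment bound by truncation and monotone convergence *)

Theorem theorem12 (R : realType) (N : nat) (lam : 'I_N -> R)
    (C : set 'rV[R]_N) (h : R -> \bar R) (g : nat -> R)
    (psi : N.-tuple nat -> 'rV[R]_N)
    (lam_ge0 : forall i, 0 <= lam i)
    (C_region : rate_region C) (h_utility : utility h) (g_weight : weight g)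
    (psi_service : service_rates C h g psi)
    (irr : irreducible lam psi)
    (nu : 'rV[R]_N) (eps : R) (nu_C : C nu) (eps_gt0 : 0 < eps)
    (lam_nu : forall i, lam i < nu ord0 i - eps)
    (pi : probability (N.-tuple nat) R)
    (pi_stationary : stationary_distribution lam psi pi)
    (d : measure_display) (Omega : measurableType d)
    (P : probability Omega R) (X : {RV P >-> N.-tuple nat})
    (X_law : forall B : set (N.-tuple nat), measurable B ->
       distribution P X B = pi B) :
  (\sum_(i < N) (utility_deriv h (nu ord0 i))%:E
       * 'E_P[fun w => g (tnth (X w) i)]
   <= (eps^-1)%:E * \sum_(i < N) (utility_deriv h (nu ord0 i))%:E
       * 'E_P[fun w => increment g (tnth (X w) i)])%E.
Proof.
have nu_gt0 i : 0 < nu ord0 i.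
  by have := eps_gt0; have := lam_ge0 i; have := lam_nu i; lra.
pose w i := utility_deriv h (nu ord0 i).
have w_ge0 i : 0 <= w i by apply/ltW/utility_deriv_gt0.
have g_ge0 k : 0 <= g k := weight_ge0 g_weight k.
have incr_ge0 k : 0 <= increment g k.
  by rewrite subr_ge0 ltW// (weight_increasing g_weight).
have psi_bounds := service_bounds psi_service.
have meas (f : N.-tuple nat -> \bar R) : measurable_fun setT f.
  exact: tuple_nat_measurable_fun.
(* Only linearity for nonnegative integrands is used, so the moments may be infinite here. *)
have weighted_expectation (f : nat -> R) : (forall k, 0 <= f k) ->
    (\sum_(i < N) (w i)%:E * 'E_P[fun x => f (tnth (X x) i)]
     = \int[pi]_x (\sum_i w i * f (tnth x i))%:E)%E.
  move=> f0; under [RHS]eq_integral do rewrite -sumEFin.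
  rewrite ge0_integral_sum//; last first.
    by move=> i x _; rewrite lee_fin mulr_ge0.
  apply: eq_bigr => i _.
  under [RHS]eq_integral do rewrite EFinM.
  rewrite ge0_integralZl//; last 2 first.
  - by move=> x _; rewrite lee_fin.
  - by rewrite lee_fin.
  rewrite unlock; congr (_ * _)%E.
  apply: (ge0_integral_law (f := fun x => (f (tnth x i))%:E)) => //.
  by move=> x; rewrite lee_fin.
rewrite !weighted_expectation//.
pose G x := \sum_i w i * g (tnth x i).
pose I x := \sum_i w i * increment g (tnth x i).
pose V := potential h g nu.
have G_ge0 x : 0 <= G x by apply: sumr_ge0 => i _; rewrite mulr_ge0.
have I_ge0 x : 0 <= I x by apply: sumr_ge0 => i _; rewrite mulr_ge0.
have V_ge0 x : 0 <= V x by exact: potential_ge0 lam_nu _.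
pose F (n : nat) := [set x | V x <= n%:R].
have mF n : measurable (F n) by exact: tuple_nat_measurable.
have F_int n : (\int[pi]_(x in F n) (G x)%:E <= eps^-1%:E * \int[pi]_x (I x)%:E)%E.
  pose c x := Num.max (n%:R - V x) 0.
  have c_ge0 x : 0 <= c x by rewrite le_max lexx orbT.
  have c_le x : c x <= n%:R by rewrite ge_max lerBlDr lerDl V_ge0 ler0n.
  pose q x := \sum_i (lam i + psi x ord0 i).
  pose B x := \sum_i (lam i * c (arrival x i) + psi x ord0 i * c (departure x i)).
  have psi_ge0 x i : 0 <= psi x ord0 i by case: (psi_bounds x i).
  have q_ge0 x : 0 <= q x by apply: sumr_ge0 => i _; rewrite addr_ge0.
  have B_ge0 x : 0 <= B x.
    by apply: sumr_ge0 => i _; rewrite addr_ge0// mulr_ge0.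
  (* Finiteness allows this term to be cancelled from both sides below. *)
  have fin_q : (\int[pi]_x (q x * c x)%:E)%E \is a fin_num.
    apply: (@integral_bounded_fin _ _ _ _ ((\sum_i (lam i + 1)) * n%:R)) => x.
    rewrite mulr_ge0//= ler_pM//; apply: ler_sum => i _.
    by rewrite lerD2l; case: (psi_bounds x i).
  have drift x : ((q x * c x)%:E + eps%:E * ((fun x => (G x)%:E) \_ (F n)) x
      <= (B x)%:E + (I x)%:E)%E.
    rewrite /patch; case: ifPn => [|xF].
      rewrite inE => xF; rewrite -EFinM -!EFinD lee_fin.
      exact: (@truncated_drift _ _ _ _ _ _ _ _ _ lam_ge0 h_utility g_weight
        psi_service nu_C eps_gt0 lam_nu n%:R x xF).
    (* Outside [F n] the truncated function vanishes, and so does the whole left side. *)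
    rewrite mule0 adde0 -EFinD lee_fin [c x]max_r ?mulr0 ?addr_ge0//.
    by move: xF; rewrite notin_setE /F/= => /negP; rewrite -ltNge subr_le0 => /ltW.
  have : (\int[pi]_x (q x * c x)%:E + eps%:E * \int[pi]_(x in F n) (G x)%:E
      <= \int[pi]_x (q x * c x)%:E + \int[pi]_x (I x)%:E)%E.
    have GF_ge0 x : (0 <= ((fun x => (G x)%:E) \_ (F n)) x)%E.
      by apply: erestrict_ge0 => y _; rewrite lee_fin.
    rewrite [in X in (X <= _)%E](integral_mkcond (F n)) -ge0_integralZl//; last first.
      by rewrite lee_fin ltW.
    rewrite -ge0_integralD//; last 2 first.
    - by move=> x _; rewrite lee_fin mulr_ge0.
    - by move=> x _; rewrite mule_ge0// lee_fin ltW.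
    apply: (@le_trans _ _ (\int[pi]_x ((B x)%:E + (I x)%:E))%E).
      apply: ge0_le_integral_nonmeasurable => x _; last exact: drift.
      by rewrite adde_ge0// ?mule_ge0// lee_fin ?mulr_ge0// ltW.
    rewrite ge0_integralD//; last 2 first.
    - by move=> x _; rewrite lee_fin.
    - by move=> x _; rewrite lee_fin.
    rewrite leeD2r//.
    exact: (stationary_generator lam_ge0 psi_bounds pi_stationary c_ge0 c_le).
  by rewrite leeD2lE// muleC -lee_pdivlMr// muleC.
have FT : \bigcup_n F n = setT.
  apply/seteqP; split => // x _; exists (Num.truncn (V x)).+1 => //.
  exact/ltW/truncnS_gt.
(* The bound [F_int] is uniform in [n], and the sets [F n] increase to the whole state space. *)
have G_cvg : (\int[pi]_(x in F n) (G x)%:E @[n --> \oo]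
    --> \int[pi]_x (G x)%:E)%E.
  rewrite -FT; apply: ge0_nondecreasing_set_cvg_integral => //.
  - move=> m n mn; apply/subsetPset => x /= xm.
    by apply: le_trans xm _; rewrite ler_nat.
  - by move=> n; exact: measurable_funTS.
  - by move=> n x _; rewrite lee_fin.
rewrite -/(\int[pi]_x (G x)%:E)%E -/(\int[pi]_x (I x)%:E)%E.
rewrite -(cvg_lim _ G_cvg)//; apply: lime_le; first exact: cvgP G_cvg.
exact: nearW.
Qed.
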